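(* Let $S$ and $T$ be compact subsets of $\mathbb{TP}(X)$, with $S$ lower tropically convex and $T$ upper tropically convex. Let $S_0=\{\underline{\pi}_S(\gamma)\mid\gamma\in T\}$ and $T_0=\{\overline{\pi}_T(\gamma)\mid\gamma\in S\}$. Then $S_0$ and $T_0$ are isometric under $\overline{\pi}_T|_{S_0}:S_0\to T_0$ and $\underline{\pi}_S|_{T_0}:T_0\to S_0$, which are inverse maps.
   Context: $X$ is a locally compact Hausdorff space with a Borel measure $\mu$ with $\mu(X)\in(0,\infty)$, such that no nonconstant $f\in BC(X)$ equals a constant $\mu$-a.e. $\mathbb{TP}(X)=BC(X)/\{\text{constants}\}$ with metric $\rho([f],[g])=\sup(f-g)-\inf(f-g)$. A set is lower (resp. upper) tropically convex if it contains, with $[f],[g]$, all $[\min(a+f,b+g)]$ (resp. $[\max(a+f,b+g)]$), $a,b\in\mathbb R$. For compact lower (resp. upper) tropically convex $T$ and $\gamma\in\mathbb{TP}(X)$, the lower tropical projection $\underline{\pi}_T(\gamma)$ (resp. upper tropical projection $\overline{\pi}_T(\gamma)$) is the unique element of $T$ minimizing $\alpha\mapsto\left(\int_X(h-\inf h)^pd\mu\right)^{1/p}$ (resp. $\alpha\mapsto\left(\int_X(\sup h-h)^pd\mu\right)^{1/p}$), where $[h]=\alpha-\gamma$, simultaneously for all $p\in[1,\infty)$. *)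

(* Defs.v *)
From HB Require Import structures.
From mathcomp Require Import all_boot all_order all_algebra.
From mathcomp Require Import generic_quotient ring_quotient.
From mathcomp Require Import all_classical all_reals all_analysis.
From mathcomp Require Import lra.

Set Implicit Arguments.
Unset Strict Implicit.
Unset Printing Implicit Defensive.

Import Order.TTheory GRing.Theory Num.Theory.
Import numFieldNormedType.Exports.

Local Open Scope classical_set_scope.
Local Open Scope ring_scope.
Local Open Scope quotient_scope.

(* The library's measurable types are pointed, whence [ptopologicalType]: a   *)
(* space carrying a nonzero measure is nonempty.                              *)

Section BoundedContinuous.
Context {X : ptopologicalType} {R : realType}.
Implicit Types (f g : X -> R) (c : R).

Definition bc_pred : {pred X -> R} :=
  fun f => `[< continuous f /\ bounded_fun f >].

Lemma bounded_fun_norm_leP f :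
  bounded_fun f <-> exists M, forall x, `|f x| <= M.
Proof.
split=> [[M [_ fM]]|[M fM]].
  exists (M + 1) => x; apply: (fM (M + 1)) => //.
  by rewrite ltrDl.
by exists M; split=> [|N MN x _ /=]; rewrite ?num_real// (le_trans (fM x))// ltW.
Qed.

Lemma bc_predP f :
  reflect (continuous f /\ exists M, forall x, `|f x| <= M) (f \in bc_pred).
Proof.
apply: (iffP idP) => [/asboolP[cf /bounded_fun_norm_leP]//|[cf bf]].
by apply/asboolP; split=> //; apply/bounded_fun_norm_leP.
Qed.

Lemma bc_zmod_closed : zmod_closed bc_pred.
Proof.
split=> [|f g /bc_predP[cf [M fM]] /bc_predP[cg [N gN]]];
  apply/bc_predP; split.
- by move=> x; apply: cvg_cst.
- by exists 0 => x; rewrite normr0.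
- by move=> x; apply: cvgB; [apply: cf|apply: cg].
- by exists (M + N) => x; rewrite (le_trans (ler_normB _ _))// lerD.
Qed.

HB.instance Definition _ := GRing.isZmodClosed.Build (X -> R) bc_pred
  bc_zmod_closed.

Lemma bc_pred_cst c : (fun=> c) \in bc_pred.
Proof.
by apply/bc_predP; split=> [x|]; [exact: cvg_cst|exists `|c|].
Qed.

Lemma bc_pred_min f g :
  f \in bc_pred -> g \in bc_pred -> (f \min g) \in bc_pred.
Proof.
move=> /bc_predP[cf [M fM]] /bc_predP[cg [N gN]]; apply/bc_predP; split.
  by move=> x; apply: continuous_min; [apply: cf|apply: cg].
exists (M + N) => x /=.
have := fM x; have := gN x; rewrite minEle !ler_norml; case: ifP => _; lra.
Qed.

Lemma bc_pred_max f g :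
  f \in bc_pred -> g \in bc_pred -> (f \max g) \in bc_pred.
Proof.
move=> /bc_predP[cf [M fM]] /bc_predP[cg [N gN]]; apply/bc_predP; split.
  by move=> x; apply: continuous_max; [apply: cf|apply: cg].
exists (M + N) => x /=.
have := fM x; have := gN x; rewrite maxEle !ler_norml; case: ifP => _; lra.
Qed.

End BoundedContinuous.

Record bcfun (X : ptopologicalType) (R : realType) :=
  BCFun { bcval :> X -> R; bcvalP : bcval \in bc_pred }.

HB.instance Definition _ X R := [isSub for @bcval X R].
HB.instance Definition _ X R := [Choice of bcfun X R by <:].
HB.instance Definition _ X R := [SubChoice_isSubZmodule of bcfun X R by <:].

Section BCOperations.
Context {X : ptopologicalType} {R : realType}.
Implicit Types f g : bcfun X R.

Definition bc_cst (c : R) : bcfun X R := BCFun (bc_pred_cst c).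
Definition bc_min f g : bcfun X R := BCFun (bc_pred_min (bcvalP f) (bcvalP g)).
Definition bc_max f g : bcfun X R := BCFun (bc_pred_max (bcvalP f) (bcvalP g)).

Definition is_constant f : Prop := exists c, forall x, f x = c.

Definition const_pred : {pred bcfun X R} := fun f => `[< is_constant f >].

Lemma const_zmod_closed : zmod_closed const_pred.
Proof.
split=> [|f g /asboolP[c fc] /asboolP[d gd]]; apply/asboolP.
  by exists 0.
by exists (c - d) => x; rewrite -(fc x) -(gd x).
Qed.

HB.instance Definition _ := GRing.isZmodClosed.Build (bcfun X R) const_pred
  const_zmod_closed.

Definition bc_sup f : R := sup (range f).
Definition bc_inf f : R := inf (range f).
Definition osc f : R := bc_sup f - bc_inf f.

Lemma bc_has_sup f : has_sup (range f).
Proof.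
split; first by exists (f point), point.
have /bc_predP[_ [M fM]] := bcvalP f.
by exists M => _ [x _ <-]; exact: le_trans (ler_norm _) (fM x).
Qed.

Lemma bc_has_inf f : has_inf (range f).
Proof.
split; first by exists (f point), point.
have /bc_predP[_ [M fM]] := bcvalP f.
by exists (- M) => _ [x _ <-]; have := fM x; rewrite ler_norml => /andP[].
Qed.

Lemma bc_sup_ge f x : f x <= bc_sup f.
Proof. by apply: ub_le_sup; [case: (bc_has_sup f)|exists x]. Qed.

Lemma bc_inf_le f x : bc_inf f <= f x.
Proof. by apply: ge_inf; [case: (bc_has_inf f)|exists x]. Qed.

Lemma osc_leP f c : osc f <= c <-> forall x y, f x - f y <= c.
Proof.
split=> [fc x y|fc].
  by rewrite (le_trans _ fc)// lerB ?bc_sup_ge ?bc_inf_le.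
rewrite /osc lerBlDr; apply: ge_sup; first by case: (bc_has_sup f).
move=> _ [x _ <-]; rewrite -lerBlDl.
apply: lb_le_inf; first by case: (bc_has_inf f).
by move=> _ [y _ <-]; have := fc x y; lra.
Qed.

Lemma osc_ge f x y : f x - f y <= osc f.
Proof. by move: x y; apply/osc_leP. Qed.

Lemma osc_const f : is_constant f -> osc f = 0.
Proof.
move=> [c fc]; apply/le_anti/andP; split.
  by apply/osc_leP => x y; rewrite !fc subrr.
by rewrite (le_trans _ (osc_ge f point point))// subrr.
Qed.

Lemma osc0_const f : osc f = 0 -> is_constant f.
Proof.
move=> f0; exists (f point) => x.
by have := osc_ge f x point; have := osc_ge f point x; rewrite f0; lra.
Qed.

Lemma bcD f g x : (f + g) x = f x + g x. Proof. by []. Qed.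

Lemma bcN f x : (- f) x = - f x. Proof. by []. Qed.

Lemma oscN f : osc (- f) = osc f.
Proof.
apply/le_anti/andP; split; apply/osc_leP => x y.
  by rewrite !bcN; have := osc_ge f y x; lra.
by have := osc_ge (- f) y x; rewrite !bcN; lra.
Qed.

Lemma oscD f g : osc (f + g) <= osc f + osc g.
Proof.
apply/osc_leP => x y; have := osc_ge f x y; have := osc_ge g x y.
by rewrite !bcD; lra.
Qed.

Lemma osc_eq f g : is_constant (f - g) -> osc f = osc g.
Proof.
move=> cfg; have c0 := osc_const cfg; apply/le_anti/andP; split.
  by have := oscD (f - g) g; rewrite subrK c0 add0r.
have := oscD (g - f) f; rewrite subrK -opprB oscN c0 add0r; exact.
Qed.

Lemma sub_inf_eq f g x :
  is_constant (f - g) -> f x - bc_inf f = g x - bc_inf g.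
Proof.
move=> [c fgc]; have fE y : f y = g y + c by have := fgc y; rewrite bcD bcN; lra.
suff -> : bc_inf f = bc_inf g + c by rewrite fE; lra.
apply/le_anti/andP; split.
  rewrite -lerBlDr; apply: lb_le_inf; first by case: (bc_has_inf g).
  by move=> _ [y _ <-]; have := bc_inf_le f y; rewrite fE; lra.
apply: lb_le_inf; first by case: (bc_has_inf f).
by move=> _ [y _ <-]; have := bc_inf_le g y; rewrite fE; lra.
Qed.

Lemma sup_sub_eq f g x :
  is_constant (f - g) -> bc_sup f - f x = bc_sup g - g x.
Proof.
move=> [c fgc]; have fE y : f y = g y + c by have := fgc y; rewrite bcD bcN; lra.
suff -> : bc_sup f = bc_sup g + c by rewrite fE; lra.
apply/le_anti/andP; split.
  apply: ge_sup; first by case: (bc_has_sup f).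
  by move=> _ [y _ <-]; have := bc_sup_ge g y; rewrite fE; lra.
rewrite -lerBrDr; apply: ge_sup; first by case: (bc_has_sup g).
by move=> _ [y _ <-]; have := bc_sup_ge f y; rewrite fE; lra.
Qed.

End BCOperations.

Definition TP (X : ptopologicalType) (R : realType) : Type :=
  Quotient.quot (@const_pred X R).

HB.instance Definition _ X R := EqQuotient.on (TP X R).
HB.instance Definition _ X R := Choice.on (TP X R).
HB.instance Definition _ X R := GRing.Zmodule.on (TP X R).

Definition tclass {X : ptopologicalType} {R : realType} (f : bcfun X R) :
  TP X R := \pi_(TP X R) f.

Section TropicalMetric.
Context {X : ptopologicalType} {R : realType}.
Implicit Types (f g : bcfun X R) (a b c : TP X R).

Lemma tclass_eqP f g : tclass f = tclass g <-> is_constant (f - g).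
Proof.
split=> [/eqP|fg]; first by rewrite -Quotient.idealrBE => /asboolP.
by apply/eqP; rewrite -Quotient.idealrBE; apply/asboolP.
Qed.

Lemma tclass_repr a : tclass (repr a) = a.
Proof. exact: reprK. Qed.

Definition tdist a b : R := osc (repr a - repr b).

Lemma tdistE f g : tdist (tclass f) (tclass g) = bc_sup (f - g) - bc_inf (f - g).
Proof.
rewrite -/(osc _); apply: osc_eq.
have /tclass_eqP[c fc] := tclass_repr (tclass f).
have /tclass_eqP[d gd] := tclass_repr (tclass g).
exists (c - d) => x; have := fc x; have := gd x.
by rewrite !(bcD, bcN); lra.
Qed.

Lemma tdistxx a : tdist a a = 0.
Proof. by rewrite /tdist subrr; apply: osc_const; exists 0. Qed.

Lemma tdist_positivity a b : tdist a b = 0 -> a = b.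
Proof.
by move=> /osc0_const/tclass_eqP; rewrite !tclass_repr.
Qed.

Lemma tdist_sym a b : tdist a b = tdist b a.
Proof. by rewrite /tdist -opprB oscN. Qed.

Lemma tdist_triangle b a c : tdist a c <= tdist a b + tdist b c.
Proof. by rewrite /tdist -(subrKA (repr b)) oscD. Qed.

HB.instance Definition _ := isMetric.Build R (TP X R)
  tdistxx tdist_positivity tdist_sym tdist_triangle.

End TropicalMetric.

Definition lower_tconvex {X : ptopologicalType} {R : realType}
    (T : set (TP X R)) : Prop :=
  forall f g : bcfun X R, T (tclass f) -> T (tclass g) ->
  forall a b : R, T (tclass (bc_min (bc_cst a + f) (bc_cst b + g))).

Definition upper_tconvex {X : ptopologicalType} {R : realType}
    (T : set (TP X R)) : Prop :=
  forall f g : bcfun X R, T (tclass f) -> T (tclass g) ->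
  forall a b : R, T (tclass (bc_max (bc_cst a + f) (bc_cst b + g))).

Definition borel (X : ptopologicalType) := g_sigma_algebraType (@open X).
HB.instance Definition _ (X : ptopologicalType) :=
  Measurable.on (borel X).

Section TropicalProjection.
Context {X : ptopologicalType} {R : realType}.
Variable mu : {measure set (borel X) -> \bar R}.
Implicit Types (T : set (TP X R)) (a b c : TP X R) (p : R).

Definition lower_cost p a : \bar R :=
  let h := repr a in
  ((\int[mu]_x ((h x - bc_inf h) `^ p)%:E) `^ p^-1)%E.

Definition upper_cost p a : \bar R :=
  let h := repr a in
  ((\int[mu]_x ((bc_sup h - h x) `^ p)%:E) `^ p^-1)%E.

Lemma lower_costE p (h : bcfun X R) : lower_cost p (tclass h) =
  ((\int[mu]_x ((h x - bc_inf h) `^ p)%:E) `^ p^-1)%E.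
Proof.
have hh := (tclass_eqP _ _).1 (tclass_repr (tclass h)).
rewrite /lower_cost; apply: (f_equal (fun z => poweR z p^-1)).
apply: eq_integral => x _; apply: (f_equal (fun z => (powR z p)%:E)).
exact: sub_inf_eq x hh.
Qed.

Lemma upper_costE p (h : bcfun X R) : upper_cost p (tclass h) =
  ((\int[mu]_x ((bc_sup h - h x) `^ p)%:E) `^ p^-1)%E.
Proof.
have hh := (tclass_eqP _ _).1 (tclass_repr (tclass h)).
rewrite /upper_cost; apply: (f_equal (fun z => poweR z p^-1)).
apply: eq_integral => x _; apply: (f_equal (fun z => (powR z p)%:E)).
exact: sup_sub_eq x hh.
Qed.

Definition is_minimizer (cost : TP X R -> \bar R) T c a : Prop :=
  T a /\ forall b, T b -> (cost (a - c)%R <= cost (b - c)%R)%E.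

Definition is_lower_tproj T c a : Prop :=
  forall p, 1 <= p -> unique (is_minimizer (lower_cost p) T c) a.

Definition is_upper_tproj T c a : Prop :=
  forall p, 1 <= p -> unique (is_minimizer (upper_cost p) T c) a.

(* The default value 0 is never used when T is nonempty, compact and lower    *)
(* (resp. upper) tropically convex.                                           *)
Definition lower_tproj T c : TP X R := xget 0 [set a | is_lower_tproj T c a].
Definition upper_tproj T c : TP X R := xget 0 [set a | is_upper_tproj T c a].

End TropicalProjection.

(* Main.v *)
Require Import Defs.
From mathcomp Require Import all_boot all_order all_algebra.
From mathcomp Require Import all_classical all_reals all_analysis.
From mathcomp Require Import measurable_realfun lra.

Import Order.TTheory GRing.Theory Num.Theory.
Import numFieldNormedType.Exports.

Set Implicit Arguments.
Unset Strict Implicit.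
Unset Printing Implicit Defensive.

Local Open Scope classical_set_scope.
Local Open Scope ring_scope.

(* The lower projection of [g] onto S is the class of the least function f
   with [f] in S and f >= g: a minimizer of the L^1 cost (which exists by
   compactness) must lie below every competitor h, since otherwise min(f, h)
   would have a strictly smaller cost, and such a least f minimizes every L^p
   cost at once. Dually, the upper projection of [g] onto T is the class of the
   greatest function below g. The projections are then adjoint: if [g] is in T,
   f is least above g in S and h is greatest below f in T, then g <= h <= f, so
   f is also least above h. Both projections are nonexpansive because least
   elements are monotone and commute with adding constants; two mutually
   inverse nonexpansive maps are isometries. *)

(** * Continuity of Lipschitz maps and equality almost everywhere from integrals *)

Lemma lipschitz_continuous_real {R : realType} (M : metricType R) (k : R)
    (F : M -> R) :
  (forall a b, F b - F a <= k * mdist a b) -> continuous F.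
Proof.
move=> Fk a; apply/cvgrPdist_lt => e e0; near=> b.
(* The sign of k is arbitrary; [|k| + 1] is a positive bound for it, so the radius is positive. *)
have ab : mdist a b < e / (`|k| + 1).
  near: b; have := nbhsx_ballx a (e / (`|k| + 1)).
  by rewrite ballEmdist; apply; rewrite divr_gt0// ltr_wpDl.
have kab : `|F a - F b| <= k * mdist a b.
  rewrite ler_norml; have := Fk a b; have := Fk b a.
  by rewrite (metric_sym b a); lra.
apply: le_lt_trans kab _; rewrite ltr_pdivlMr ?ltr_wpDl// in ab.
apply: le_lt_trans ab; rewrite mulrC ler_wpM2l ?mdist_ge0//.
by rewrite (le_trans (ler_norm k))// lerDl.
Unshelve. all: by end_near. Qed.

Lemma nonexpansive_continuous {R : realType} (M N : metricType R)
    (F : M -> N) :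
  (forall a b, mdist (F a) (F b) <= mdist a b) -> continuous F.
Proof.
move=> F1 a; apply/cvg_ballP => e e0; near=> b.
rewrite ballEmdist /=; apply: le_lt_trans (F1 a b) _; near: b.
by have := nbhsx_ballx a e e0; rewrite ballEmdist.
Unshelve. all: by end_near. Qed.

(** The difference v - u is nonnegative and, the two integrals being equal, has integral 0, so it
    vanishes almost everywhere. *)
Lemma ae_eq_of_le_Rintegral d (T : measurableType d) (R : realType)
    (mu : {measure set T -> \bar R}) (u v : T -> R) :
  mu.-integrable setT (EFin \o u) -> mu.-integrable setT (EFin \o v) ->
  (forall x, u x <= v x) -> \int[mu]_x v x <= \int[mu]_x u x ->
  {ae mu, forall x, u x = v x}.
Proof.
move=> iu iv uv ivu.
have ivBu : mu.-integrable setT (EFin \o (fun x => v x - u x)).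
  exact (integrableB measurableT iv iu).
have I0 : \int[mu]_x (v x - u x) = 0.
  rewrite RintegralB//; apply/eqP; rewrite subr_eq0 eq_le ivu /=.
  exact: le_Rintegral.
have : (\int[mu]_x `|(v x - u x)%R%:E| = 0)%E.
  transitivity (\int[mu]_x (v x - u x)%R%:E)%E.
    by apply: eq_integral => x _ /=; rewrite ger0_norm ?subr_ge0.
  by rewrite -[LHS]fineK ?integrable_fin_num// -[fine _]/(Rintegral _ _ _) I0.
move/ae_eq_integral_abs => /(_ measurableT (measurable_int mu ivBu)).
by apply: filterS => x /(_ I) [] ?; lra.
Qed.

(** * Classes of functions, negation, and least and greatest representatives *)

Section TropicalQuotient.
Context {X : ptopologicalType} {R : realType}.
Implicit Types (f g h : bcfun X R) (a b : TP X R).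

Lemma tclassB f g : tclass (f - g) = tclass f - tclass g.
Proof. exact: raddfB. Qed.

Lemma tclassN f : tclass (- f) = - tclass f.
Proof. exact: raddfN. Qed.

Lemma tclass_shift (c : R) f : tclass (bc_cst c + f) = tclass f.
Proof. by apply/tclass_eqP; exists c => x; rewrite !(bcD, bcN) /= addrK. Qed.

Lemma mdist_tclass f g : mdist (tclass f) (tclass g) = osc (f - g).
Proof. exact: tdistE. Qed.

Lemma mdist_repr a b : mdist a b = osc (repr a - repr b).
Proof. by []. Qed.

Lemma mdistN a b : mdist (- a) (- b) = mdist a b.
Proof.
rewrite -(tclass_repr a) -(tclass_repr b) -!tclassN !mdist_tclass -oscN.
by rewrite opprB opprK addrC.
Qed.

Lemma bc_infN f : bc_inf (- f) = - bc_sup f.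
Proof.
rewrite /bc_inf /inf; congr (- sup _); apply/seteqP; split=> [_ [_ [x _ <-] <-]|].
  by exists x; rewrite // bcN opprK.
by move=> _ [x _ <-]; exists (- f x); [exists x|rewrite opprK].
Qed.

(** The representative of the class of f with infimum 0; the lower cost is its L^p norm. *)
Definition excess f : bcfun X R := f - bc_cst (bc_inf f).

Lemma excessE f x : excess f x = f x - bc_inf f.
Proof. by []. Qed.

Lemma excess_ge0 f x : 0 <= excess f x.
Proof. by rewrite excessE subr_ge0 bc_inf_le. Qed.

Lemma bc_inf_ge f (c : R) : (forall x, c <= f x) -> c <= bc_inf f.
Proof.
move=> cf; apply: lb_le_inf; first by case: (bc_has_inf f).
by move=> _ [x _ <-].
Qed.

(** This bound makes the L^1 cost Lipschitz for the tropical metric. *)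
Lemma excess_le_osc f g x : excess f x <= excess g x + osc (f - g).
Proof.
suff : f x - g x + bc_inf g - osc (f - g) <= bc_inf f by rewrite !excessE; lra.
apply: bc_inf_ge => y; have := osc_ge (f - g) x y; have := bc_inf_le g y.
by rewrite !(bcD, bcN); lra.
Qed.

(** Negation exchanges minima and maxima, which reduces upper projections to lower ones. *)
Lemma lower_tconvexN {T : set (TP X R)} :
  upper_tconvex T -> lower_tconvex (-%R @` T).
Proof.
move=> uT f g [a Ta af] [b Tb bg] s t.
have Tf : T (tclass (- f)) by rewrite tclassN -af opprK.
have Tg : T (tclass (- g)) by rewrite tclassN -bg opprK.
exists (tclass (bc_max (bc_cst (- s) + - f) (bc_cst (- t) + - g))).
  exact: uT.
rewrite -tclassN; apply/tclass_eqP; exists 0 => x.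
rewrite !(bcD, bcN) /= !fctE minEle maxEle.
by case: ifP; case: ifP; lra.
Qed.

Lemma compactN {T : set (TP X R)} : compact T -> compact (-%R @` T).
Proof.
apply: continuous_compact; apply: continuous_subspaceT.
by apply: nonexpansive_continuous => a b; rewrite mdistN.
Qed.

(** Leastness is among functions rather than classes: every translate of a representative competes,
    which fixes the additive constant of f. *)
Definition least_above (S : set (TP X R)) g f : Prop :=
  [/\ S (tclass f), forall x, g x <= f x &
      forall h, S (tclass h) -> (forall x, g x <= h x) ->
      forall x, f x <= h x].

Definition greatest_below (T : set (TP X R)) g f : Prop :=
  [/\ T (tclass f), forall x, f x <= g x &
      forall h, T (tclass h) -> (forall x, h x <= g x) ->
      forall x, h x <= f x].

Lemma greatest_belowN T g f :
  least_above (-%R @` T) (- g) f -> greatest_below T g (- f).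
Proof.
case=> -[a Ta af] gf fmin; split=> [|x|h Th hg x].
- by rewrite tclassN -af opprK.
- by rewrite bcN; have := gf x; rewrite bcN; lra.
(* The bound h <= - f is read off from f <= - h, where - h competes with f. *)
- have := fmin (- h); rewrite !bcN => /(_ _ _ x); rewrite bcN.
  suff : forall u v : R, u <= - v -> v <= - u by move=> + H; apply; apply: H;
    [exists (tclass h); rewrite ?tclassN|move=> y; rewrite !bcN lerN2].
  by move=> u v; lra.
Qed.

Lemma least_aboveN T g f :
  greatest_below T g f -> least_above (-%R @` T) (- g) (- f).
Proof.
case=> Tf fg fmax; split=> [|x|h [a Ta ah] gh x].
- by exists (tclass f); rewrite ?tclassN.
- by rewrite !bcN lerN2.
- rewrite bcN lerNl; have := fmax (- h) _ _ x; rewrite bcN; apply.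
    by rewrite tclassN -ah opprK.
  by move=> y; rewrite bcN; have := gh y; rewrite bcN; lra.
Qed.

(** With c the infimum and d the oscillation of g - g', one has g' + c <= g <= g' + c + d. Leastness
    carries both bounds over, so f - f' takes values in [c, c + d]. *)
Lemma least_above_nonexpansive S g g' f f' :
  least_above S g f -> least_above S g' f' -> osc (f - f') <= osc (g - g').
Proof.
move=> [Sf gf fmin] [Sf' gf' fmin'].
set c := bc_inf (g - g'); set d := osc (g - g').
have lo x : c <= g x - g' x by exact: (bc_inf_le (g - g') x).
have hi x : g x - g' x <= c + d.
  by have := bc_sup_ge (g - g') x; rewrite bcD bcN /d /osc -/c; lra.
have ff' x : f x <= (c + d) + f' x.
  apply: (fmin (bc_cst (c + d) + f')); first by rewrite tclass_shift.
  by move=> y; rewrite bcD /=; have := hi y; have := gf' y; lra.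
have f'f x : f' x <= - c + f x.
  apply: (fmin' (bc_cst (- c) + f)); first by rewrite tclass_shift.
  by move=> y; rewrite bcD /=; have := lo y; have := gf y; lra.
apply/osc_leP => x y; rewrite !(bcD, bcN).
by have := ff' x; have := f'f y; lra.
Qed.

Lemma least_above_greatest_below S T g f h :
  T (tclass g) -> least_above S g f -> greatest_below T f h ->
  least_above S h f.
Proof.
move=> Tg [Sf gf fmin] [_ hf hmax]; split=> // k Sk hk; apply: fmin => // x.
exact: le_trans (hmax g Tg gf x) (hk x).
Qed.

Lemma greatest_below_least_above S T g f h :
  S (tclass g) -> greatest_below T g f -> least_above S f h ->
  greatest_below T h f.
Proof.
move=> Sg [Tf fg fmax] [_ fh hmin]; split=> // k Tk kh; apply: fmax => // x.
exact: le_trans (kh x) (hmin g Sg fg x).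
Qed.

(** Pointwise domination of the excess is what lets one f minimize the cost for all p
    simultaneously. *)
Lemma excess_least_above S g f h : least_above S g f -> S (tclass h) ->
  forall x, excess (f - g) x <= excess (h - g) x.
Proof.
move=> [_ gf fmin] Sh x; rewrite !excessE.
have f0 : 0 <= bc_inf (f - g).
  by apply: bc_inf_ge => y; rewrite bcD bcN subr_ge0.
(* The right-hand side is the lowest translate of h above g, so it competes with f. *)
have fh : f x <= - bc_inf (h - g) + h x.
  apply: (fmin (bc_cst (- bc_inf (h - g)) + h)); first by rewrite tclass_shift.
  by move=> y; rewrite bcD /=; have := bc_inf_le (h - g) y; rewrite bcD bcN; lra.
by rewrite !(bcD, bcN); lra.
Qed.

End TropicalQuotient.

(** * Existence of least elements and their identification with lower projections *)

Section Projection.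
Context {R : realType} {X : ptopologicalType}.
Context (mu : {measure set (borel X) -> \bar R}).
Context (mu_gt0 : (0 < mu [set: X])%E) (mu_fin : (mu [set: X] < +oo)%E).
Context (mu_const : forall f : bcfun X R,
      (exists c : R, {ae mu, forall x, f x = c}) -> is_constant f).
Implicit Types (f g h : bcfun X R) (S T : set (TP X R)) (a b c : TP X R).

Lemma measurable_bcfun f : measurable_fun [set: borel X] (f : borel X -> R).
Proof.
move=> _; apply: (measurability _ (RGenOpens.measurableE R)) => //.
move=> _ [_ [s [t ->] <-]]; rewrite setTI; apply: sub_sigma_algebra.
have /bc_predP[/continuousP cf _] := bcvalP f.
exact/cf/interval_open.
Qed.

Lemma integrable_bounded (u : borel X -> R) (M : R) :
  measurable_fun setT u -> (forall x, `|u x| <= M) ->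
  mu.-integrable setT (EFin \o u).
Proof.
move=> mu_u uM; apply: measurable_bounded_integrable => //.
by apply/bounded_fun_norm_leP; exists M.
Qed.

Lemma integrable_bcfun f : mu.-integrable [set: borel X] (EFin \o f).
Proof.
have /bc_predP[_ [M fM]] := bcvalP f.
exact: integrable_bounded (measurable_bcfun f) fM.
Qed.

Lemma excess_le f x : excess f x <= osc f.
Proof. by rewrite !excessE /osc lerB// bc_sup_ge. Qed.

Lemma integrable_excess_powR f p : 0 <= p ->
  mu.-integrable [set: borel X] (EFin \o (fun x => excess f x `^ p)).
Proof.
move=> p0; apply: (@integrable_bounded _ (osc f `^ p)).
  by apply: (measurableT_comp (measurable_powR p)); exact: measurable_bcfun.
move=> x; rewrite ger0_norm ?powR_ge0// ge0_ler_powR ?nnegrE ?excess_ge0//.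
  exact: le_trans (excess_ge0 f x) (excess_le f x).
exact: excess_le.
Qed.

Lemma le_lower_cost p f g : 0 < p ->
  (lower_cost mu p (tclass f) <= lower_cost mu p (tclass g))%E =
  (\int[mu]_x (excess f x `^ p) <= \int[mu]_x (excess g x `^ p)).
Proof.
move=> p0; have pV0 : 0 < p^-1 by rewrite invr_gt0.
have cE h : lower_cost mu p (tclass h) =
    ((\int[mu]_x (excess h x `^ p)) `^ p^-1)%:E.
  rewrite lower_costE -poweR_EFin; congr (poweR _ _).
  by rewrite /Rintegral fineK// integrable_fin_num// integrable_excess_powR// ltW.
have I0 h : \int[mu]_x (excess h x `^ p) \in Num.nneg.
  by rewrite nnegrE; apply: Rintegral_ge0 => // x _; exact: powR_ge0.
rewrite !cE lee_fin; apply/idP/idP; last exact: ge0_ler_powR (ltW pV0) _ _ _ _.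
by apply: contraLR; rewrite -!ltNge; exact: gt0_ltr_powR.
Qed.

#[local] Instance ae_borel_properfilter : ProperFilter (almost_everywhere mu).
Proof. exact: ae_properfilter_algebraOfSetsType. Qed.

(** By [mu_const] the difference f - g is constant, and positivity of [mu] supplies a point where it
    is 0. *)
Lemma ae_eq_bcfun f g : {ae mu, forall x, f x = g x} -> forall x, f x = g x.
Proof.
move=> fg.
have fg0 : {ae mu, forall x, (f - g) x = 0}.
  by apply: filterS fg => x fgx; rewrite bcD bcN fgx subrr.
have [|c fgc x] := mu_const (f := f - g); first by exists 0.
have [y fgy] := filter_ex fg0.
have : (f - g) x = 0 by rewrite fgc -(fgc y).
by rewrite bcD bcN; lra.
Qed.

Lemma least_above_exists S g : S !=set0 -> compact S -> lower_tconvex S ->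
  exists f, least_above S g f.
Proof.
move=> S0 cS lS; pose F a := \int[mu]_x excess (repr a - g) x.
(* The L^1 cost is Lipschitz with constant the total mass, so it attains a minimum on S. *)
have Flip a b : F b - F a <= fine (mu setT) * mdist a b.
  rewrite mulrC -(Rintegral_cst mu measurableT) lerBlDl -RintegralD//; last 2 first.
  - exact: integrable_bcfun.
  - exact: (integrable_bcfun (bc_cst _)).
  apply: le_Rintegral => //; first exact: integrable_bcfun.
    exact: (integrable_bcfun (excess (repr a - g) + bc_cst (mdist a b))).
  move=> x _; rewrite metric_sym mdist_repr.
  have := excess_le_osc (repr b - g) (repr a - g) x.
  by rewrite opprB subrKA.
have [|a /set_mem Sa Fa] := compact_EVT_min S0 cS (f := F).
  by apply: continuous_subspaceT; exact: lipschitz_continuous_real Flip.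
(* The lowest translate of the minimizer above g: f - g is the excess of [repr a - g]. *)
pose f := bc_cst (- bc_inf (repr a - g)) + repr a.
have Sf : S (tclass f) by rewrite tclass_shift tclass_repr.
have gf x : g x <= f x.
  have := bc_inf_le (repr a - g) x; rewrite /f !(bcD, bcN) /=; lra.
exists f; split=> // h Sh gh.
pose m := bc_min (bc_cst 0 + f) (bc_cst 0 + h).
have mE x : m x = Num.min (f x) (h x) by rewrite /m /= !fctE !add0r.
have mf x : m x <= f x by rewrite mE ge_min lexx.
have gm x : g x <= m x by rewrite mE le_min gf gh.
suff fm : forall x, m x = f x by move=> x; rewrite -fm mE ge_min lexx orbT.
apply: ae_eq_bcfun.
apply: (ae_eq_of_le_Rintegral (integrable_bcfun m) (integrable_bcfun f) mf).
have Fa' : F a = \int[mu]_x f x - \int[mu]_x g x.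
  rewrite -RintegralB//; try exact: integrable_bcfun.
  by apply: eq_Rintegral => x _; rewrite !excessE /f !(bcD, bcN) /=; lra.
(* Since m >= g, the infimum of m - g is nonnegative and its excess is at most m - g. Minimality of
   a then gives that the integral of f is at most that of m. *)
have Fm : F (tclass m) <= \int[mu]_x m x - \int[mu]_x g x.
  rewrite -RintegralB//; try exact: integrable_bcfun.
  apply: le_Rintegral => //; first exact: integrable_bcfun.
    by apply: (integrable_bcfun (m - g)).
  move=> x _; rewrite !excessE (@sub_inf_eq _ _ _ (m - g)); last first.
    by apply/tclass_eqP; rewrite !tclassB tclass_repr.
  rewrite bcD bcN gerDl oppr_le0; apply: bc_inf_ge => y.
  by rewrite bcD bcN subr_ge0.
have := le_trans (Fa _ (mem_set (lS _ _ Sf Sh 0 0))) Fm.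
by rewrite Fa' lerD2r.
Qed.

Lemma least_above_is_lower_tproj S g f :
  least_above S g f -> is_lower_tproj mu S (tclass g) (tclass f).
Proof.
move=> fS p p1; have p0 : 0 < p by exact: lt_le_trans p1.
have [Sf _ _] := fS.
have cE b : lower_cost mu p (b - tclass g) = lower_cost mu p (tclass (repr b - g)).
  by rewrite tclassB tclass_repr.
have le_pow h : S (tclass h) ->
    forall x, excess (f - g) x `^ p <= excess (h - g) x `^ p.
  move=> Sh x; rewrite ge0_ler_powR ?nnegrE ?excess_ge0 ?(ltW p0)//.
  exact: excess_least_above fS Sh x.
have le_int h : S (tclass h) ->
    \int[mu]_x (excess (f - g) x `^ p) <= \int[mu]_x (excess (h - g) x `^ p).
  move=> Sh; apply: (le_Rintegral measurableT
    (integrable_excess_powR (f - g) (ltW p0))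
    (integrable_excess_powR (h - g) (ltW p0))) => x _.
  exact: le_pow.
split; first split.
- exact: Sf.
- move=> b Sb; rewrite (cE b) -tclassB (le_lower_cost _ _ p0); apply: le_int.
  by rewrite tclass_repr.
(* Uniqueness: for another minimizer the p-th powers agree almost everywhere, so the excesses agree
   everywhere and the two functions differ by a constant. *)
move=> b [Sb /(_ _ Sf)]; rewrite (cE b) -tclassB (le_lower_cost _ _ p0) => cbf.
rewrite -(tclass_repr b) in Sb *.
have ae_pow := ae_eq_of_le_Rintegral
  (integrable_excess_powR (f - g) (ltW p0))
  (integrable_excess_powR (repr b - g) (ltW p0)) (le_pow _ Sb) cbf.
have ef : forall x, excess (f - g) x = excess (repr b - g) x.
  apply: ae_eq_bcfun; apply: filterS ae_pow => x.
  by apply: (powR_injective p0); rewrite nnegrE; exact: excess_ge0.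
apply/tclass_eqP; exists (bc_inf (f - g) - bc_inf (repr b - g)) => x.
by move: (ef x); clear; rewrite !excessE !(bcD, bcN); lra.
Qed.

Lemma lower_tprojE S g f :
  least_above S g f -> lower_tproj mu S (tclass g) = tclass f.
Proof.
move=> /least_above_is_lower_tproj fS; apply: xget_unique => // a aS.
(* Uniqueness for the single exponent 1 already determines the projection. *)
have [[Sf fmin] _] := fS 1 (lexx _); have [_ funiq] := aS 1 (lexx _).
by apply: funiq; split.
Qed.

(** * Upper projections by negation *)

Lemma upper_costN p a : upper_cost mu p a = lower_cost mu p (- a).
Proof.
rewrite -(tclass_repr a) -tclassN upper_costE lower_costE.
congr (poweR _ _); apply: eq_integral => x _.
by rewrite bc_infN bcN opprK addrC.
Qed.

Lemma is_upper_tprojN T c a :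
  is_lower_tproj mu (-%R @` T) (- c) (- a) <-> is_upper_tproj mu T c a.
Proof.
have cE p b : lower_cost mu p (- b - - c) = upper_cost mu p (b - c).
  by rewrite upper_costN opprB opprK addrC.
have minE p b : is_minimizer (lower_cost mu p) (-%R @` T) (- c) (- b) <->
    is_minimizer (upper_cost mu p) T c b.
  split=> [[[b' Tb' /oppr_inj <-] bmin]|[Tb bmin]].
    split=> // d Td; rewrite -!cE; apply: bmin; by exists d.
  split; first by exists b.
  by move=> _ [d Td <-]; rewrite !cE; exact: bmin.
split=> H p p1; have [/minE am aun] := H p p1; split=> // b.
  by move=> /minE/aun/oppr_inj.
by rewrite -(opprK b) => /minE/aun ->.
Qed.

Lemma upper_tprojE T g f :
  greatest_below T g f -> upper_tproj mu T (tclass g) = tclass f.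
Proof.
move=> /least_aboveN/least_above_is_lower_tproj; rewrite !tclassN.
move=> /is_upper_tprojN fT; apply: xget_unique => // a aT.
have [[Tf fmin] _] := fT 1 (lexx _); have [_ funiq] := aT 1 (lexx _).
by apply: funiq; split.
Qed.

Lemma greatest_below_exists T g : T !=set0 -> compact T -> upper_tconvex T ->
  exists f, greatest_below T g f.
Proof.
move=> [a Ta] cT uT.
have NT0 : -%R @` T !=set0 by exists (- a), a.
have [f fT] := least_above_exists (- g) NT0 (compactN cT) (lower_tconvexN uT).
by exists (- f); exact: greatest_belowN.
Qed.

(** * Nonexpansiveness and adjointness of the projections *)

Lemma lower_tprojP S c : S !=set0 -> compact S -> lower_tconvex S ->
  exists2 f, least_above S (repr c) f & lower_tproj mu S c = tclass f.
Proof.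
move=> S0 cS lS; have [f fS] := least_above_exists (repr c) S0 cS lS.
by exists f => //; rewrite -(lower_tprojE fS) tclass_repr.
Qed.

Lemma upper_tprojP T c : T !=set0 -> compact T -> upper_tconvex T ->
  exists2 f, greatest_below T (repr c) f & upper_tproj mu T c = tclass f.
Proof.
move=> T0 cT uT; have [f fT] := greatest_below_exists (repr c) T0 cT uT.
by exists f => //; rewrite -(upper_tprojE fT) tclass_repr.
Qed.

Lemma lower_tproj_nonexpansive S a b :
  S !=set0 -> compact S -> lower_tconvex S ->
  mdist (lower_tproj mu S a) (lower_tproj mu S b) <= mdist a b.
Proof.
move=> S0 cS lS; have [f fS ->] := lower_tprojP a S0 cS lS.
have [f' fS' ->] := lower_tprojP b S0 cS lS.
by rewrite mdist_tclass mdist_repr; exact: least_above_nonexpansive fS fS'.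
Qed.

Lemma upper_tproj_nonexpansive T a b :
  T !=set0 -> compact T -> upper_tconvex T ->
  mdist (upper_tproj mu T a) (upper_tproj mu T b) <= mdist a b.
Proof.
move=> T0 cT uT; have [f /least_aboveN fT ->] := upper_tprojP a T0 cT uT.
have [f' /least_aboveN fT' ->] := upper_tprojP b T0 cT uT.
(* Both distances pass through the isometry [-%R], with - a written as the class of [- repr a], to
   match the least elements in - T. *)
rewrite -mdistN -!tclassN mdist_tclass -mdistN mdist_repr.
rewrite -[a]tclass_repr -[b]tclass_repr -!tclassN -mdist_repr mdist_tclass.
exact: least_above_nonexpansive fT fT'.
Qed.

Lemma lower_upper_lower S T c :
  S !=set0 -> compact S -> lower_tconvex S ->
  T !=set0 -> compact T -> upper_tconvex T -> T c ->
  lower_tproj mu S (upper_tproj mu T (lower_tproj mu S c)) =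
  lower_tproj mu S c.
Proof.
move=> S0 cS lS T0 cT uT Tc; have [f fS ->] := lower_tprojP c S0 cS lS.
have [h hT] := greatest_below_exists f T0 cT uT.
rewrite (upper_tprojE hT); apply: lower_tprojE.
(* Because c lies in T, [repr c] itself competes with h. *)
by apply: least_above_greatest_below fS hT; rewrite tclass_repr.
Qed.

Lemma upper_lower_upper S T c :
  S !=set0 -> compact S -> lower_tconvex S ->
  T !=set0 -> compact T -> upper_tconvex T -> S c ->
  upper_tproj mu T (lower_tproj mu S (upper_tproj mu T c)) =
  upper_tproj mu T c.
Proof.
move=> S0 cS lS T0 cT uT Sc; have [f fT ->] := upper_tprojP c T0 cT uT.
have [h hS] := least_above_exists f S0 cS lS.
rewrite (lower_tprojE hS); apply: upper_tprojE.
by apply: greatest_below_least_above fT hS; rewrite tclass_repr.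
Qed.

End Projection.

Theorem theorem8p1 (R : realType) (X : ptopologicalType)
    (mu : {measure set (borel X) -> \bar R})
    (Xlc : locally_compact [set: X]) (XT2 : hausdorff_space X)
    (mu_gt0 : (0 < mu [set: X])%E) (mu_fin : (mu [set: X] < +oo)%E)
    (mu_const : forall f : bcfun X R,
      (exists c : R, {ae mu, forall x, f x = c}) -> is_constant f)
    (S T : set (TP X R)) (S_neq0 : S !=set0) (T_neq0 : T !=set0)
    (S_compact : compact S) (T_compact : compact T)
    (S_lower : lower_tconvex S) (T_upper : upper_tconvex T) :
  let S0 := [set lower_tproj mu S c | c in T] in
  let T0 := [set upper_tproj mu T c | c in S] in
  [/\ set_fun S0 T0 (upper_tproj mu T),
      set_fun T0 S0 (lower_tproj mu S),
      (forall a, S0 a -> lower_tproj mu S (upper_tproj mu T a) = a) /\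
      (forall b, T0 b -> upper_tproj mu T (lower_tproj mu S b) = b),
      forall a a', S0 a -> S0 a' ->
        mdist (upper_tproj mu T a) (upper_tproj mu T a') = mdist a a' &
      forall b b', T0 b -> T0 b' ->
        mdist (lower_tproj mu S b) (lower_tproj mu S b') = mdist b b'].
Proof.
move=> S0 T0.
have S0S a : S0 a -> S a.
  move=> [c _ <-].
  by have [f [Sf _ _] ->] :=
    lower_tprojP mu_gt0 mu_fin mu_const c S_neq0 S_compact S_lower.
have T0T b : T0 b -> T b.
  move=> [c _ <-].
  by have [f [Tf _ _] ->] :=
    upper_tprojP mu_gt0 mu_fin mu_const c T_neq0 T_compact T_upper.
have lu a : S0 a -> lower_tproj mu S (upper_tproj mu T a) = a.
  by move=> [c Tc <-]; exact: lower_upper_lower.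
have ul b : T0 b -> upper_tproj mu T (lower_tproj mu S b) = b.
  by move=> [c Sc <-]; exact: upper_lower_upper.
split=> //.
- by move=> a /S0S Sa; exists a.
- by move=> b /T0T Tb; exists b.
- move=> a a' S0a S0a'; apply/le_anti/andP; split.
    exact: upper_tproj_nonexpansive.
  (* Only the distance between a and a' on the left is rewritten, as that between the lower
     projections of their images. *)
  by rewrite -{1}(lu a S0a) -{1}(lu a' S0a'); exact: lower_tproj_nonexpansive.
- move=> b b' T0b T0b'; apply/le_anti/andP; split.
    exact: lower_tproj_nonexpansive.
  by rewrite -{1}(ul b T0b) -{1}(ul b' T0b'); exact: upper_tproj_nonexpansive.
Qed.
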